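(* For any reals $a>0$ and $x\ge1$, $$p(x,a)=\infty,\qquad\text{where}\quad p(x,a)=\frac1{A(x)}\sum_{j\ge0}\Big|\sum_{k\le x}a_k^2\cos(\lambda_kja)\Big| .$$
   Context: $(\lambda_k)_{k\ge1}$ is an increasing unbounded sequence of irrational numbers which is linearly independent over $\mathbb Q$. $(a_k)_{k\ge 1}$ is a sequence of non-vanishing real numbers, and $A(x)=\sum_{k\le x}a_k^2$. (The quantity $p(x,a)$ is the decoupling coefficient of the stationary Gaussian sequence $X_x(ja)$, $j\ge0$, where $X_x(t)=\sum_{k\le x}a_k(g_k\cos\lambda_kt+g'_k\sin\lambda_kt)$ with $g_k,g'_k$ independent standard Gaussian variables.) *)

(* Defs.v *)
From mathcomp Require Import all_boot all_order all_algebra.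
From mathcomp Require Import all_classical all_reals all_analysis.

Set Implicit Arguments.
Unset Strict Implicit.
Unset Printing Implicit Defensive.

Import Order.TTheory GRing.Theory Num.Theory.
Local Open Scope ring_scope.

(* All sequences are indexed by k >= 1; the term of index 0 is never used.  *)
(* For real x >= 0, the sum over 1 <= k <= x is the sum over                *)
(* 1 <= k < (Num.truncn x).+1, with Num.truncn x the integer part of x.     *)

Definition Qlin_indep (R : realType) (lambda : nat -> R) : Prop :=
  forall (n : nat) (q : nat -> rat),
    \sum_(1 <= k < n.+1) ratr (q k) * lambda k = 0 ->
    forall k, (1 <= k <= n)%N -> q k = 0.

Definition energy (R : realType) (a_ : nat -> R) (x : R) : R :=
  \sum_(1 <= k < (Num.truncn x).+1) a_ k ^+ 2.

(* The covariance at times 0 and t of the stationary Gaussian process       *)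
(* X_x(t) = sum_(k <= x) a_k (g_k cos(lambda_k t) + g'_k sin(lambda_k t)).  *)
Definition covariance_sum (R : realType) (lambda a_ : nat -> R) (x t : R) : R :=
  \sum_(1 <= k < (Num.truncn x).+1) a_ k ^+ 2 * cos (lambda k * t).

Definition decoupling_coeff (R : realType) (lambda a_ : nat -> R) (x a : R)
    : \bar R :=
  (((energy a_ x)^-1)%:E *
    \sum_(0 <= j <oo) (`|covariance_sum lambda a_ x (j%:R * a)|)%:E)%E.

(* Main.v *)
(**
If the series had a finite sum [S], then for the covariance [f] and every [N]
the double sum of [f ((i - j) a) cos (lambda_1 (i - j) a)] over [i, j < N]
would be at most [2 N S]. On the other hand, every kernel [cos (t (i - j))]
is positive semidefinite, so by the product formula for cosines all terms of
[f] contribute nonnegatively to this double sum, and the frequency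
[lambda_1 - lambda_1 = 0] alone contributes [a_1^2 N^2 / 2].
*)
Require Import Defs.
From mathcomp Require Import all_boot all_order all_algebra.
From mathcomp Require Import all_classical all_reals all_analysis.
From mathcomp Require Import ring lra.

Import Order.TTheory GRing.Theory Num.Theory.
Local Open Scope classical_set_scope.
Local Open Scope ring_scope.

Lemma cosM (R : realType) (u v : R) :
  cos u * cos v = 2^-1 * cos (u + v) + 2^-1 * cos (u - v).
Proof. rewrite cosB cosD; lra. Qed.

(** The subtraction formula makes each entry [cos cos + sin sin], so the double sum factors; this is
    the real form of the squared modulus of the sum of [exp (I t i)]. *)
Lemma sum_cos_kernel (R : realType) (t : R) (N : nat) :
  \sum_(0 <= i < N) \sum_(0 <= j < N) cos (t * (i%:R - j%:R)) =
  (\sum_(0 <= i < N) cos (t * i%:R)) ^+ 2 +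
  (\sum_(0 <= i < N) sin (t * i%:R)) ^+ 2.
Proof.
rewrite !expr2 !mulr_suml -big_split /=; apply: eq_bigr => i _.
rewrite !mulr_sumr -big_split /=; apply: eq_bigr => j _.
by rewrite mulrBr cosB.
Qed.

Lemma sum_cos_kernel_ge0 (R : realType) (t : R) (N : nat) :
  0 <= \sum_(0 <= i < N) \sum_(0 <= j < N) cos (t * (i%:R - j%:R)).
Proof. by rewrite sum_cos_kernel addr_ge0 ?sqr_ge0. Qed.

(** The product is the mean of the cosine kernels of frequencies [s + t] and [s - t]. *)
Lemma sum_cosM_kernel_ge0 (R : realType) (s t : R) (N : nat) :
  0 <= \sum_(0 <= i < N) \sum_(0 <= j < N)
         cos (s * (i%:R - j%:R)) * cos (t * (i%:R - j%:R)).
Proof.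
under eq_bigr => i _ do under eq_bigr => j _ do rewrite cosM -mulrDl -mulrBl.
under eq_bigr => i _ do rewrite big_split -!mulr_sumr /=.
by rewrite big_split -!mulr_sumr /= addr_ge0 // mulr_ge0 ?sum_cos_kernel_ge0.
Qed.

(** At equal frequencies the difference kernel is constantly 1 and contributes the left side; the
    kernel of frequency [t + t] only adds to it. *)
Lemma sum_cos_sqr_kernel_ge (R : realType) (t : R) (N : nat) :
  N%:R ^+ 2 / 2 <= \sum_(0 <= i < N) \sum_(0 <= j < N)
    cos (t * (i%:R - j%:R)) * cos (t * (i%:R - j%:R)).
Proof.
under eq_bigr => i _ do under eq_bigr => j _ do
  rewrite cosM -mulrDl subrr cos0 mulr1.
under eq_bigr => i _ do
  rewrite big_split -!mulr_sumr /= sumr_const_nat subn0.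
rewrite big_split -!mulr_sumr /= sumr_const_nat subn0.
rewrite [leLHS](_ : _ = 2^-1 *+ N *+ N).
  by rewrite lerDr mulr_ge0 ?sum_cos_kernel_ge0.
by rewrite -mulrnA -(mulr_natl 2^-1) natrM expr2.
Qed.

(** Row [i], cut at the diagonal, is two runs of values of [g] at consecutive naturals, each summing
    to at most [S]. *)
Lemma sum_toeplitz_le (R : realType) (g : R -> R) (S : R) (N : nat)
  (g_even : forall u, g (- u) = g u)
  (g_sum : forall n, \sum_(0 <= j < n) g j%:R <= S)
  (g_ge0 : forall u, 0 <= g u) :
  \sum_(0 <= i < N) \sum_(0 <= j < N) g (i%:R - j%:R) <= N%:R * (S *+ 2).
Proof.
rewrite -[N in leRHS]subn0 mulr_natl -sumr_const_nat.
apply: ler_sum_nat => i /andP[_ iN].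
rewrite (big_cat_nat (leq0n i) (ltnW iN)) mulr2n lerD //.
  (* Read backwards, the entries left of the diagonal are [g 1, ..., g i]; adding [g 0] gives a
     partial sum. *)
  rewrite big_nat_rev /= add0n.
  apply: le_trans (g_sum i.+1).
  rewrite big_nat_recl // -[leLHS]add0r lerD //.
  apply: ler_sum_nat => j /andP[_ ji].
  by rewrite -natrB ?leq_subr // subKn.
(* From the diagonal on, shifting [j] by [i] and evenness give [g 0, g 1, ...]. *)
rewrite -{1}[i]add0n big_addn.
under eq_bigr => j _ do rewrite -g_even opprB natrD addrK.
exact: g_sum.
Qed.

Lemma covariance_sum_even (R : realType) (lambda a_ : nat -> R) (x t : R) :
  covariance_sum lambda a_ x (- t) = covariance_sum lambda a_ x t.
Proof. by apply: eq_bigr => k _; rewrite mulrN cosN. Qed.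

Lemma sum_covariance_kernel_ge (R : realType) (lambda a_ : nat -> R)
  (x a : R) (N : nat) (x_ge1 : 1 <= x) :
  a_ 1%N ^+ 2 * (N%:R ^+ 2 / 2) <=
  \sum_(0 <= i < N) \sum_(0 <= j < N)
    covariance_sum lambda a_ x ((i%:R - j%:R) * a) *
    cos (lambda 1%N * a * (i%:R - j%:R)).
Proof.
have n_gt0 : (0 < Num.truncn x)%N by rewrite truncn_gt0.
under eq_bigr => i _ do under eq_bigr => j _ do rewrite mulr_suml.
under eq_bigr => i _ do rewrite exchange_big_nat /=.
rewrite exchange_big_nat /=.
under eq_bigr => k _.
  under eq_bigr => i _.
    under eq_bigr => j _.
      rewrite -mulrA [(_ - _) * a]mulrC [lambda k * (_ * _)]mulrA.
      over.
    rewrite -mulr_sumr; over.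
  rewrite -mulr_sumr; over.
(* With the sum over [k] outermost, [k = 1] meets its own frequency and gives the main term; the
   other terms are nonnegative. *)
rewrite big_ltn //= -[leLHS]addr0 lerD //.
  by rewrite ler_wpM2l ?sqr_ge0 ?sum_cos_sqr_kernel_ge.
by apply: sumr_ge0 => k _; rewrite mulr_ge0 ?sqr_ge0 ?sum_cosM_kernel_ge0.
Qed.

Lemma covariance_partial_sums_unbounded (R : realType)
  (lambda a_ : nat -> R) (x a S : R) (a1_neq0 : a_ 1%N != 0)
  (x_ge1 : 1 <= x) :
  ~ forall n, \sum_(0 <= j < n) `|covariance_sum lambda a_ x (j%:R * a)| <= S.
Proof.
move=> S_ub.
have c_gt0 : 0 < a_ 1%N ^+ 2 by rewrite exprn_even_gt0.
pose g u := `|covariance_sum lambda a_ x (u * a)|.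
have g_even u : g (- u) = g u by rewrite /g mulNr covariance_sum_even.
have bound N : a_ 1%N ^+ 2 * (N%:R ^+ 2 / 2) <= N%:R * (S *+ 2).
  apply: le_trans (sum_toeplitz_le _ g S N g_even S_ub (fun=> normr_ge0 _)).
  apply: le_trans (sum_covariance_kernel_ge _ lambda a_ x a N x_ge1) _.
  apply: ler_sum => i _; apply: ler_sum => j _.
  rewrite (le_trans (ler_norm _)) // normrM ler_piMr //.
  by rewrite ler_norml cos_geN1 cos_le1.
(* Chosen so that [N * a_1^2 > 4 S]: the quadratic lower bound then exceeds the linear upper bound
   [2 N S]. *)
set N := (Num.truncn (S * 4 / a_ 1%N ^+ 2)).+1.
have := truncnS_gt (S * 4 / a_ 1%N ^+ 2); rewrite -/N ltr_pdivrMr // => N_gt.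
have := bound N; rewrite leNgt => /negP; apply.
have N_gt0 : 0 < N%:R :> R by rewrite ltr0n.
rewrite [ltRHS](_ : _ = N%:R * (N%:R * a_ 1%N ^+ 2 / 2)); last by ring.
by rewrite ltr_pM2l //; lra.
Qed.

Theorem theorem5p1 (R : realType) (lambda a_ : nat -> R)
  (lambda_incr : forall k l : nat, (1 <= k)%N -> (k < l)%N ->
     lambda k < lambda l)
  (lambda_unbounded : ~ has_ubound [set lambda k | k in [set k | (1 <= k)%N]])
  (lambda_irrational : forall k : nat, (1 <= k)%N -> irrational (lambda k))
  (lambda_indep : Qlin_indep lambda)
  (a_neq0 : forall k : nat, (1 <= k)%N -> a_ k != 0)
  (a x : R) (a_gt0 : 0 < a) (x_ge1 : 1 <= x) :
  decoupling_coeff lambda a_ x a = +oo%E.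
Proof.
have a1_neq0 : a_ 1%N != 0 by exact: a_neq0.
have energy_gt0 : 0 < energy a_ x.
  rewrite /energy big_ltn ?ltnS ?truncn_gt0 // ltr_pwDl ?sumr_ge0 //.
    by rewrite exprn_even_gt0.
  by move=> k _; rewrite sqr_ge0.
rewrite /decoupling_coeff.
set series_sum := (\sum_(0 <= j <oo) _)%E.
(* Strict positivity of the energy matters here, since [0 * +oo] is 0 in the extended reals. *)
suff -> : series_sum = +oo%E by rewrite gt0_muley // lte_fin invr_gt0.
case sumE : series_sum => [S| |] //; exfalso.
- apply: (@covariance_partial_sums_unbounded R lambda a_ x a S) => // n.
  rewrite -lee_fin -sumEFin -sumE.
  by apply: nneseries_lim_ge => j _ _; rewrite lee_fin.
- have : (0 <= series_sum)%E.
    by apply: nneseries_ge0 => j _ _; rewrite lee_fin.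
  by rewrite sumE.
Qed.
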